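(* Let $S\subset\mathbb{Z}$ be a set of size $N>0$ and let $t$ be a positive integer. Suppose that $$\sum_{x\in\mathbb{Z}}\min(1_S*1_S(x),t)\le (2+\delta)Nt$$ for some real $\delta>0$, and that $\delta+\frac{5t}{N}\le\frac14$. Then there is an arithmetic progression $P\subset\mathbb{Z}$ of length at most $(1+2\delta)N+6t$ containing all but at most $\frac{5t}{2}$ points of $S$.
   Context: Here $S$ is finite, $N=|S|$, and $1_S$ is the indicator function of $S$. For functions $f,g:G\to\mathbb{C}$ on an abelian group $G$ (with counting measure), $f*g(x)=\sum_{y\in G}f(y)g(x-y)$; thus $1_S*1_S(x)=\#\{(a,b)\in S\times S: a+b=x\}$. The length of a (finite) arithmetic progression is its number of elements. *)

(* Defs.v *)
From mathcomp Require Import all_boot all_order all_algebra.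
From mathcomp Require Import finmap.
From mathcomp Require Import all_classical all_reals numfun.

Set Implicit Arguments.
Unset Strict Implicit.
Unset Printing Implicit Defensive.

Import Order.TTheory GRing.Theory Num.Theory.

Local Open Scope classical_set_scope.
Local Open Scope ring_scope.

(* [\sum_(y \in A) F y] is the sum over the support of F in A when that support
   is finite (and 0 otherwise); it is finite as soon as f or g has finite
   support. *)
Definition conv (G : zmodType) (R : nzRingType) (f g : G -> R) (x : G) : R :=
  \sum_(y \in [set: G]) f y * g (x - y).

(* The step is nonzero, so the number of terms k is the cardinality of P. *)
Definition is_arith_prog (P : {fset int}) : Prop :=
  exists (a d : int) (k : nat),
    [/\ d != 0, (0 < k)%N & P = [fset (a + i%:Z * d)%R | i in iota 0 k]%fset].

(* Main.v *)
Require Import Defs.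
From mathcomp Require Import all_boot all_order all_algebra.
From mathcomp Require Import finmap.
From mathcomp Require Import all_classical all_reals numfun.
From mathcomp Require Import zify lra.

Set Implicit Arguments.
Unset Strict Implicit.
Unset Printing Implicit Defensive.

Import Order.TTheory GRing.Theory Num.Theory.

(* Call a sum t-popular if it has at least t representations, and let Phi be
   the left-hand side of the hypothesis.  Adding the t smallest and the t
   largest elements of S to all of S, and comparing with the sums made from the
   next t elements at either end, one finds l among the t smallest and u among
   the t largest elements such that l + a and u + a are both t-popular for most
   a in S.  Modulo m = u - l these sums coincide, so the image A of the part of
   S in [l, u) has popular doubling at most (1 + 2 delta) N t + O(t^2), which is
   close to 3/2 |A| t at worst.

   In a finite abelian group this forces the differences with at least 2t
   representations to form a subgroup H: such a difference d satisfies
   t |A u (A - d)| <= popsum A t, so it has more than |A|/2 representations, and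
   then d + e has at least 2t of them whenever d and e do.  All but t/2 elements
   of A lie in one coset of H, and t |H| <= popsum A t.  The integers of [l, u)
   in that coset form the progression. *)

Local Open Scope ring_scope.

Lemma leq_sum_subset_nat (T : finType) (P Q : pred T) (F : T -> nat) :
  (forall x, P x -> Q x) -> (\sum_(x | P x) F x <= \sum_(x | Q x) F x)%N.
Proof.
move=> sPQ; rewrite [X in (X <= _)%N]big_mkcond [X in (_ <= X)%N]big_mkcond /=.
by apply: leq_sum => x _; case: ifP => // /sPQ ->.
Qed.

(** * Popular sums and popular differences in a finite abelian group *)

Section FiniteGroup.
Variable G : finZmodType.
Implicit Types (A X Y H : {set G}) (d x y z : G).

Definition reps A z := #|[set a in A | z - a \in A]|.
Definition diffs A d := #|[set a in A | a - d \in A]|.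
Definition popsum A t := (\sum_z minn (reps A z) t)%N.

Arguments reps A z%_R.
Arguments diffs A d%_R.

(** Both sides count the pairs [(x, y)] in [X] times [Y] whose sum satisfies [P]. *)
Lemma sum_card_translate X Y (P : pred G) :
  (\sum_(z | P z) #|[set x in X | (z - x)%R \in Y]| =
   \sum_(x in X) #|[set y in Y | P (x + y)%R]|)%N.
Proof.
transitivity (\sum_(z | P z) \sum_(x in X | (z - x)%R \in Y) 1)%N.
  by apply: eq_bigr => z _; rewrite sum1dep_card.
rewrite (exchange_big_dep (mem X)) /=; last by move=> z x _ /andP[].
apply: eq_bigr => x xX; rewrite -sum1dep_card.
rewrite (reindex_onto (fun y => x + y) (fun z => z - x)) /=; last first.
  by move=> z _; rewrite addrC subrK.
by apply: eq_bigl => y; rewrite xX /= addrAC subrr add0r eqxx andbT andbC.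
Qed.

Lemma sum_card_translateT X Y :
  (\sum_z #|[set x in X | (z - x)%R \in Y]| = #|X| * #|Y|)%N.
Proof.
rewrite sum_card_translate (eq_bigr (fun=> #|Y|)) ?sum_nat_const // => x _.
by apply: eq_card => y; rewrite inE andbT.
Qed.

Lemma card_translate A d : #|[set x | x + d \in A]| = #|A|.
Proof.
rewrite -(card_imset (mem A) (addIr (- d))); apply: eq_card => x.
rewrite inE; apply/idP/imsetP => [xA|[y yA ->]]; last by rewrite subrK.
by exists (x + d); rewrite // addrK.
Qed.

Lemma diffs0 A : diffs A 0 = #|A|.
Proof. by apply: eq_card => a; rewrite inE subr0 andbb. Qed.

Lemma diffsN A d : diffs A (- d) = diffs A d.
Proof.
rewrite /diffs -(card_translate _ (- d)); apply: eq_card => a.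
by rewrite !inE opprK subrK andbC.
Qed.

(** The sets [A :&: (A + d)] and [(A + d) :&: (A + d + e)] both lie in [A + d], and their
    intersection lies in [A :&: (A + d + e)]; apply inclusion-exclusion. *)
Lemma diffsD A d e : (diffs A d + diffs A e <= diffs A (d + e) + #|A|)%N.
Proof.
rewrite {1}/diffs {1}/diffs -[X in (_ + X <= _)%N](card_translate _ (- d)).
rewrite -cardsUI addnC leq_add //.
  apply: subset_leq_card; apply/fintype.subsetP => a.
  by rewrite !inE => /andP[/andP[-> _] /andP[_]]; rewrite -addrA -opprD.
rewrite -(card_translate A (- d)).
apply: subset_leq_card; apply/fintype.subsetP => a.
by rewrite !inE => /orP[] /andP[].
Qed.

Lemma sum_diffs A : (\sum_d diffs A d = #|A| ^ 2)%N.
Proof.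
rewrite -mulnn -{1}(card_imset (mem A) oppr_inj) -sum_card_translateT.
apply: eq_bigr => d _; rewrite /diffs -[LHS](card_imset _ (subrI d)).
apply: eq_card => x; rewrite inE; apply/imsetP/andP => [[a]|[/imsetP[a aA ->]]].
  by rewrite inE => /andP[aA adA] ->; rewrite subKr -opprB imset_f.
rewrite opprK => daA; exists (d + a); rewrite ?inE ?daA ?opprD ?addNKr //=.
by rewrite addrAC subrr add0r.
Qed.

(* For 2t elements x of A with x - d in A, the sums x + y with y in A u (A - d)
   are sums of two elements of A, and at most two pairs (x, y) yield the same
   pair of summands. *)
Lemma popular_diff A t d : (2 * t <= diffs A d)%N ->
  (2 * t * #|A| <= popsum A t + t * diffs A d)%N.
Proof.
(* Keeping exactly [2t] elements bounds the count at each sum by [2t], twice the truncation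
   level. *)
move=> /card_geqP[s [us ss sA]].
pose X := [set x in s]; have cX : #|X| = (2 * t)%N.
  by rewrite cardsE (card_uniqP us).
pose Y := A :|: [set y | y + d \in A].
have cY : (#|Y| + diffs A d = 2 * #|A|)%N.
  rewrite mul2n -addnn -[X in (_ = _ + X)%N](card_translate A d).
  rewrite -[RHS]cardsUI -diffsN; congr addn; apply: eq_card => a.
  by rewrite !inE opprK.
have le_w z : (#|[set x in X | (z - x)%R \in Y]| <= 2 * minn (reps A z) t)%N.
  rewrite minnMr leq_min -cX; apply/andP; split; last first.
    apply: subset_leq_card; apply/fintype.subsetP => x.
    by rewrite inE => /andP[].
  apply: (@leq_trans #|[set a in A | z - a \in A] :|:
                       [set x | x - d \in [set a in A | z - a \in A]]|).
    apply: subset_leq_card; apply/fintype.subsetP => x; rewrite !inE.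
    case/andP=> /sA; rewrite inE => /andP[-> ->].
    by rewrite /= opprB addrA (addrAC z).
  by rewrite cardsU card_translate mul2n -addnn leq_subr.
have := leq_sum (index_enum G) (fun z (_ : true) => le_w z).
rewrite sum_card_translateT -big_distrr cX -/(popsum A t) /= => le_2K.
have : (t * (#|Y| + diffs A d) = t * (2 * #|A|))%N by rewrite cY.
move: le_2K; clear; rewrite -!mulnA.
by move: #|Y| #|A| (diffs A d) => y a e; nia.
Qed.

(** By [popular_diff], [2t] representations already force [|A|/2 + t] of them, and [diffsD] turns
    two such bounds into [2t] representations of [d + e]. *)
Lemma popular_diffs_subgroup A t (H := [set d | (2 * t <= diffs A d)%N]) :
  (2 * popsum A t + 2 * t ^ 2 <= 3 * t * #|A|)%N -> (6 * t <= #|A|)%N ->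
  (0 < t)%N -> [/\ 0 \in H, {in H &, forall d e, d + e \in H} &
    {in H, forall d, - d \in H}].
Proof.
move=> hK hn t0; split.
- by rewrite inE diffs0; lia.
- move=> d e; rewrite !inE => hd he.
  have := popular_diff hd; have := popular_diff he.
  have := diffsD A d e; nia.
- by move=> d; rewrite !inE diffsN.
Qed.

(** The element [x] is the one with the fewest unpopular sums. If [x - y] is not in [H], the popular
    parts of [A + x] and [A + y] share fewer than [2t] elements, so [B] is large or [y] has many
    unpopular sums; more than [t] such [y] would make [popsum A t] too large. *)
Lemma popular_coset A t (H := [set d | (2 * t <= diffs A d)%N]) :
  (2 * popsum A t + 2 * t ^ 2 <= 3 * t * #|A|)%N -> (6 * t <= #|A|)%N ->
  (0 < t)%N ->
  exists2 x, x \in A & (#|[set y in A | (x - y)%R \notin H]| <= t)%N.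
Proof.
move=> hK hn t0.
pose B := [set z | (t <= reps A z)%N].
pose lam y := #|[set a in A | a + y \notin B]|.
have sumlam : (\sum_(y in A) lam y + t * #|B| = popsum A t)%N.
  rewrite [RHS](bigID (mem B)) addnC /=; congr addn.
    rewrite (eq_bigr (fun=> t)) => [|z]; first by rewrite sum_nat_const mulnC.
    by rewrite inE => /minn_idPr.
  transitivity (\sum_(z | z \notin B) reps A z)%N; last first.
    apply: eq_bigr => z; rewrite inE -ltnNge => lt_zt.
    by apply/esym/minn_idPl/ltnW.
  rewrite sum_card_translate; apply: eq_bigr => y _.
  by apply: eq_card => a; rewrite !inE addrC.
have [x0 x0A] : exists x, x \in A by apply/card_gt0P; lia.
case: (@arg_minnP _ x0 (mem A) lam x0A) => x xA lam_min.
exists x => //; set Z := [set y in A | _].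
have lamx : (#|A| * lam x <= popsum A t)%N.
  rewrite -sum_nat_const -sumlam; apply: leq_trans (leq_addr _ _).
  exact: leq_sum.
have lamE y : (#|A| <= lam y + #|[set z in B | (z - y)%R \in A]|)%N.
  rewrite /lam -(card_translate [set z in B | z - y \in A] y) -cardsUI.
  apply: leq_trans (leq_addr _ _); apply: subset_leq_card.
  by apply/fintype.subsetP => a aA; rewrite !inE addrK aA /= andbT orNb.
have lamZ y : y \in Z -> (2 * #|A| <= lam x + lam y + #|B| + 2 * t)%N.
  rewrite !inE -ltnNge => /andP[yA lt_d].
  have := cardsUI [set z in B | z - x \in A] [set z in B | z - y \in A].
  have: (#|[set z in B | (z - x)%R \in A] :|: [set z in B | (z - y)%R \in A]|
           <= #|B|)%N.
    apply: subset_leq_card; apply/fintype.subsetP => z.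
    by rewrite !inE => /orP[] /andP[].
  have: (#|[set z in B | (z - x)%R \in A] :&: [set z in B | (z - y)%R \in A]|
           <= diffs A (x - y))%N.
    rewrite -diffsN opprB.
    rewrite -[X in (_ <= X)%N](card_translate _ (- x)).
    apply: subset_leq_card; apply/fintype.subsetP => z; rewrite !inE.
    by rewrite opprB addrA subrK => /andP[/andP[_ ->] /andP[_ ->]].
  have := lamE x; have := lamE y; lia.
have sumZ : (#|Z| * (2 * #|A|) <=
    \sum_(y in A) lam y + #|Z| * (lam x + #|B| + 2 * t))%N.
  apply: (@leq_trans (\sum_(y in Z) (lam y + (lam x + #|B| + 2 * t)))%N).
    by rewrite -sum_nat_const; apply: leq_sum => y /lamZ; lia.
  rewrite big_split /= sum_nat_const leq_add2r.
  by apply: leq_sum_subset_nat => y; rewrite inE => /andP[].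
rewrite leqNgt; apply/negP => lt_tZ.
move: sumZ sumlam lamx hK hn t0 lt_tZ; clear.
move: (\sum_(y in A) _)%N (lam x) (popsum A t) #|A| #|B| #|Z|.
move=> L l K n b z h1 h2 h3 h4 h5 h6 h7.
(* These two bounds make [2n - l - b - 2t] nonnegative, so [z] may be lowered to [t + 1].
   Substituting [L = K - t b] then gives [n <= 5t], against [6t <= n]. *)
have l2 : (2 * l <= 3 * t)%N by nia.
have b2 : (2 * b + 2 * t <= 3 * n)%N by nia.
have : (t.+1 * (2 * n) <= L + t.+1 * (l + b + 2 * t))%N by nia.
nia.
Qed.

Lemma card_coset H x : #|[set y | x - y \in H]| = #|H|.
Proof.
rewrite -(card_imset (mem H) (subrI x)); apply: eq_card => y.
rewrite inE; apply/idP/imsetP => [xA|[z zA ->]]; last by rewrite subKr.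
by exists (x - y); rewrite // subKr.
Qed.

(** The bound [t] of [popular_coset] on the exceptional elements is halved by counting separately
    the sums inside the double of the coset and those of an exceptional element with an element of
    the coset. *)
Lemma small_popular_doubling A t :
  (2 * popsum A t + 2 * t ^ 2 <= 3 * t * #|A|)%N -> (6 * t <= #|A|)%N ->
  (0 < t)%N -> exists H x,
   [/\ [/\ 0 \in H, {in H &, forall d e, d + e \in H} &
        {in H, forall d, - d \in H}], x \in A, (t * #|H| <= popsum A t)%N &
      (2 * #|[set y in A | (x - y)%R \notin H]| <= t)%N].
Proof.
move=> hK hn t0; pose H := [set d | (2 * t <= diffs A d)%N].
have [H0 HD HN] := popular_diffs_subgroup hK hn t0.
have [x xA le_bt] := popular_coset hK hn t0.
rewrite -/H in H0 HD HN le_bt; exists H, x.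
have Hpop d : d \in H -> (2 * t <= diffs A d)%N by rewrite inE.
clearbody H.
have Hsub d e : d \in H -> (d - e \in H) = (e \in H).
  move=> dH; apply/idP/idP => [deH|eH]; last by rewrite HD ?HN.
  by rewrite -[e](subKr d) HD ?HN.
set b := #|_| in le_bt *.
pose A0 := [set y in A | x - y \in H].
have cA : (#|A0| + b = #|A|)%N.
  rewrite /b /A0 -(cardsID [set y | x - y \in H] A); congr addn.
    by apply: eq_card => y; rewrite !inE.
  by apply: eq_card => y; rewrite !inE andbC.
have cH : #|[set y | x - y \in H]| = #|H| by apply: card_coset.
have le_a0h : (#|A0| <= #|H|)%N.
  rewrite -cH; apply: subset_leq_card; apply/fintype.subsetP => y.
  by rewrite !inE => /andP[].
(* Sum [popular_diff] over [d] in [H]. Two elements of [A] differing by [d] are both in [A0] or both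
   among the [b] exceptional ones, and the pairs in [A0] number at most [|A0|^2] in total. *)
have leH : (#|H| * (2 * t * #|A|) <=
    #|H| * (popsum A t + t * b) + t * #|A0| ^ 2)%N.
  have diffA0 d : d \in H ->
      (diffs A d <= #|[set a in A0 | (a - d)%R \in A0]| + b)%N.
    move=> dH; rewrite /b /diffs; set Z := [set y in A | _].
    rewrite -cardsUI; apply: leq_trans (leq_addr _ _).
    apply: subset_leq_card; apply/fintype.subsetP => a; rewrite !inE.
    move=> /andP[aA adA]; rewrite aA adA opprB addrA addrAC addrC /=.
    case xaH : (x - a \in H); rewrite ?orbT //= orbF.
    by rewrite HD.
  have: (\sum_(d in H) #|[set a in A0 | (a - d)%R \in A0]| <= #|A0| ^ 2)%N.
    by rewrite -sum_diffs; apply: leq_sum_subset_nat.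
  rewrite -!sum_nat_const => le2.
  have : (\sum_(d in H) 2 * t * #|A| <= \sum_(d in H)
      (popsum A t + t * b + t * #|[set a in A0 | (a - d)%R \in A0]|))%N.
    apply: leq_sum => d dH; have := diffA0 d dH.
    by have /popular_diff := Hpop d dH; nia.
  rewrite big_split /= -[X in (_ <= _ + X)%N]big_distrr /=.
  by move=> h; apply: leq_trans h _; rewrite leq_add2l leq_mul2l le2 orbT.
(* A0 fills so much of its coset that all sums in its double C2 are popular. *)
have le_h : (#|H| + t <= 2 * #|A0|)%N.
  have : (0 < #|H|)%N by rewrite card_gt0; apply/set0Pn; exists 0.
  move: cA leH hK hn t0 le_bt le_a0h; clear.
  move: (popsum A t) #|A| #|A0| #|H| b => K n a h b <- h1 h2 h3 h4 h5 h6 h7.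
  (* Otherwise [h >= 2a + 1 - t], whereas [leH] and the doubling bound reduce to
     [h (a + 2t - b) <= 2a^2]; since [b <= t <= a], the two are incompatible. *)
  rewrite leqNgt; apply/negP => h8.
  have e1 : (h * (2 * K + 2 * t ^ 2) <= h * (3 * t * (a + b)))%N.
    by rewrite leq_mul2l h2 orbT.
  have e2 : (t * (h * a + 2 * (h * t)) <= t * (h * b + 2 * a ^ 2))%N by nia.
  rewrite leq_pmul2l // in e2.
  have [c cE] : exists c, (b + c = 2 * t)%N by exists (2 * t - b)%N; lia.
  have e3 : (h * (a + c) <= 2 * a ^ 2)%N by nia.
  have [k hE] : exists k, (h = k + (2 * a + 1 - t))%N.
    by exists (h - (2 * a + 1 - t))%N; lia.
  have [a' aE] : exists a', (a = t + a')%N by exists (a - t)%N; lia.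
  have e4 : ((2 * a' + t + 1) * (a' + t + c) <= 2 * (a' + t) ^ 2)%N.
    by apply: leq_trans (leq_mul _ _) (leq_trans e3 _); lia.
  have e5 : (a' * t <= a' * c)%N by rewrite leq_mul2l; apply/orP; right; lia.
  by clear -e4 e5 h4 cE h5; nia.
pose C2 := [set z | x + x - z \in H].
have cC2 : #|C2| = #|H| by apply: card_coset.
have subE y z : x + x - z - (x - y) = x - (z - y).
  by apply/eqP; rewrite subr_eq opprB addrACA (addrAC y) subrr add0r.
have popC2 z : z \in C2 -> (t <= reps A z)%N.
  rewrite inE => zH; have := cardsUI A0 [set a | z - a \in A0].
  have -> : #|[set a | z - a \in A0]| = #|A0|.
    rewrite -(card_imset (mem A0) (subrI z)); apply: eq_card => y.
    rewrite inE; apply/idP/imsetP => [yA|[w wA ->]]; last by rewrite subKr.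
    by exists (z - y); rewrite // subKr.
  have : (#|A0 :|: [set a | (z - a)%R \in A0]| <= #|H|)%N.
    rewrite -cH; apply: subset_leq_card; apply/fintype.subsetP => y.
    rewrite !inE; case/orP=> [/andP[] //|/andP[_]].
    by rewrite -subE (Hsub _ _ zH).
  have : (#|A0 :&: [set a | (z - a)%R \in A0]| <= reps A z)%N.
    apply: subset_leq_card; apply/fintype.subsetP => y.
    by rewrite !inE => /andP[/andP[-> _] /andP[->]].
  lia.
(* Each element of [C2] contributes [t]. Sums of an exceptional element with an element of [A0]
   avoid [C2], and each value arises at most [b <= t] times, so truncation loses none of these
   [b |A0|] pairs. *)
have le_K : (t * #|H| + b * #|A0| <= popsum A t)%N.
  rewrite -cC2 /popsum (bigID (mem C2)) /=; apply: leq_add.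
    rewrite mulnC -sum_nat_const; apply: leq_sum => z /popC2.
    by rewrite leq_min leqnn => ->.
  set Z := [set y in A | x - y \notin H] in b le_bt cA leH *.
  rewrite -sum_card_translateT.
  rewrite (bigID (mem C2)) /= big1 ?add0n => [|z zC].
    apply: leq_sum => z _; rewrite leq_min; apply/andP; split; last first.
      apply: leq_trans le_bt; apply: subset_leq_card.
      apply/fintype.subsetP => y.
      by rewrite inE => /andP[].
    apply: subset_leq_card; apply/fintype.subsetP => y; rewrite !inE.
    by move=> /andP[/andP[-> _] /andP[->]].
  apply: eq_card0 => y; rewrite !inE; apply/negP.
  move=> /andP[/andP[_ /negP nH] /andP[_ zyH]]; apply: nH.
  by move: zC zyH; rewrite inE -subE => /Hsub ->.
split=> //; first by apply: leq_trans le_K; apply: leq_addr.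
(* This uses [|A0| <= |H|]. With [|A0| = |A| - b], a value [b > t/2] would make the left side exceed
   [3t|A|/2 - t^2]. *)
have le_K2 : ((t + b) * #|A0| <= popsum A t)%N by nia.
move: le_K2 hK hn t0 le_bt cA; clear.
move: (popsum A t) #|A| #|A0| => K n a h1 h2 h3 h4 h5 h6.
rewrite leqNgt; apply/negP => h7; nia.
Qed.

End FiniteGroup.

(** * Sums of a finite set of integers and its extreme elements *)

Lemma leq_count_sum (T : eqType) (F : T -> nat) (q : seq T) :
  (0 < size q)%N -> exists2 a, a \in q & (size q * F a <= \sum_(b <- q) F b)%N.
Proof.
elim: q => // a [|b q] IH _.
  by exists a; rewrite ?mem_head // big_seq1 mul1n.
have [//|c cq le_c] := IH.
have [le_ac|/ltnW le_ca] := leqP (F a) (F c).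
  exists a; rewrite ?mem_head // big_cons /= mulSn leq_add2l.
  by apply: leq_trans le_c; rewrite leq_mul2l le_ac orbT.
exists c; first by rewrite inE cq orbT.
by rewrite big_cons /= mulSn leq_add.
Qed.

Lemma minn_sum_leq (T : Type) (q : seq T) (P : pred T) (F : T -> nat) t :
  (minn (\sum_(x <- q | P x) F x) t <= \sum_(x <- q | P x) minn (F x) t)%N.
Proof.
elim: q => [|x q]; first by rewrite !big_nil min0n.
rewrite !big_cons; case: (P x) => // IH.
apply: (@leq_trans (minn (F x) t + minn (\sum_(x <- q | P x) F x) t)%N); lia.
Qed.

Definition ireps (s : seq int) (x : int) := count (fun a => x - a \in s) s.
Definition sums (s : seq int) := undup [seq a + b | a <- s, b <- s].
(** Integer counterpart of [popsum]; integers outside [sums s] have no representation and would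
    contribute 0. *)
Definition ipopsum (s : seq int) t := (\sum_(x <- sums s) minn (ireps s x) t)%N.

Definition unpopular (s : seq int) t (a : int) :=
  count (fun b => (ireps s (a + b) < t)%N) s.

Lemma sum_sums_translate (s l : seq int) (a : int) (P : pred int) :
  a \in s -> uniq l -> {subset l <= s} ->
  (\sum_(x <- sums s | P x) ((x - a)%R \in l) =
   count (fun b => P (a + b)%R) l)%N.
Proof.
move=> aS ul ls; rewrite -sum1_count big_mkcond /=.
transitivity (\sum_(x <- sums s | (x - a)%R \in l) P x)%N.
  rewrite [RHS]big_mkcond; apply: eq_bigr => x _.
  by case: (P x); case: (_ \in _).
rewrite -big_filter [RHS]big_mkcond /=.
rewrite -(big_map (fun b => a + b) xpredT (fun x => P x : nat)).
apply: perm_big; apply: uniq_perm; first by rewrite filter_uniq ?undup_uniq.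
  by rewrite map_inj_uniq //; apply: addrI.
move=> x; rewrite mem_filter mem_undup; apply/andP/mapP => [[xa _]|[b bl ->]].
  by exists (x - a); rewrite // addrC subrK.
rewrite addrAC subrr add0r bl; split=> //.
by apply/allpairsP; exists (a, b); split=> //; apply: ls.
Qed.

(** Double counting of the pairs in [q] times [l] whose sum satisfies [P]. *)
Lemma sum_sums_count (s q l : seq int) (P : pred int) :
  {subset q <= s} -> uniq l -> {subset l <= s} ->
  (\sum_(x <- sums s | P x) count (fun a => (x - a)%R \in l) q =
   \sum_(a <- q) count (fun b => P (a + b)%R) l)%N.
Proof.
move=> qs ul ls.
transitivity (\sum_(x <- sums s | P x) \sum_(a <- q) ((x - a)%R \in l))%N.
  by apply: eq_bigr => x _; rewrite -sum1_count big_mkcond.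
rewrite exchange_big /=; apply: eq_big_seq => a /qs aS.
exact: sum_sums_translate.
Qed.

(* Sums of M with L ++ M ++ C lie below sums of V with C ++ V ++ U.  Together
   these sums number 2t(|s| - 2t), at most t at each popular sum, so they leave
   little room for unpopular sums involving L or U. *)
Lemma popular_extremes (L M C V U s : seq int) (t : nat) :
  s = L ++ M ++ C ++ V ++ U -> sorted <%R s -> (0 < t)%N ->
  size L = t -> size M = t -> size V = t -> size U = t ->
  exists l u : int, [/\ l \in L, u \in U &
    (t * (unpopular s t l + unpopular s t u) + 2 * t * (size s - 2 * t)
       <= ipopsum s t)%N].
Proof.
move=> sE s_sort t0 sL sM sV sU.
have us : uniq s by apply: lt_sorted_uniq.
pose AM := L ++ M ++ C; pose AV := C ++ V ++ U.
have subs q : subseq q s -> uniq q /\ {subset q <= s}.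
  by move=> qs; split; [apply: subseq_uniq us | apply: mem_subseq].
have sub_cat a b c : subseq b (a ++ b ++ c :> seq int).
  by apply: subseq_trans (suffix_subseq _ _); apply: prefix_subseq.
have [uM sMs] : uniq M /\ {subset M <= s} by apply: subs; rewrite sE.
have [uV sVs] : uniq V /\ {subset V <= s}.
  by apply: subs; rewrite sE; move: (sub_cat (L ++ M ++ C) V U); rewrite -!catA.
have [uL sLs] : uniq L /\ {subset L <= s}.
  by apply: subs; rewrite sE prefix_subseq.
have [uU sUs] : uniq U /\ {subset U <= s}.
  by apply: subs; rewrite sE !catA suffix_subseq.
have [uAM sAM] : uniq AM /\ {subset AM <= s}.
  apply: subs; rewrite sE /AM.
  by have := prefix_subseq (L ++ M ++ C) (V ++ U); rewrite -!catA.
have [uAV sAV] : uniq AV /\ {subset AV <= s}.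
  by apply: subs; rewrite sE /AV [L ++ _]catA suffix_subseq.
have ltMV : {in M & AV, forall a b, a < b} /\ {in AM & V, forall a b, a < b}.
  move: s_sort; rewrite (sorted_pairwise (@lt_trans _ _)) sE.
  rewrite !pairwise_cat => /and3P[/allrelP h1 _ /and3P[/allrelP h2 _]].
  move=> /and3P[/allrelP h3 _ _].
  split=> a b; rewrite ?mem_cat.
    by move=> aM; rewrite -!mem_cat; apply: h2.
  move=> h bV; case/or3P: h => ha.
  - by apply: h1; rewrite // !mem_cat bV /= ?orbT.
  - by apply: h2; rewrite // !mem_cat bV /= ?orbT.
  - by apply: h3; rewrite // !mem_cat bV /= ?orbT.
pose w (q l : seq int) (x : int) := count (fun a => x - a \in l) q : nat.
(* At an unpopular [x] the first summands range over the disjoint blocks [L], [M], [V], [U], so the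
   total is at most [ireps s x]. At a popular [x] the first two counts are at most [t] and cannot
   both be positive. *)
have pointwise x : (w M AM x + w V AV x +
    (ireps s x < t) * (w L s x + w U s x) <= minn (ireps s x) t)%N.
  have le_r : (w L s x + w M s x + w V s x + w U s x <= ireps s x)%N.
    have -> : ireps s x = count (fun a => x - a \in s) (L ++ M ++ C ++ V ++ U).
      by rewrite -sE.
    by rewrite !count_cat /w; lia.
  have leM : (w M AM x <= w M s x)%N by apply: sub_count => a /sAM.
  have leV : (w V AV x <= w V s x)%N by apply: sub_count => a /sAV.
  have [lt_rt|le_tr] := ltnP (ireps s x) t; first by lia.
  rewrite mul0n addn0.
  have : (w M AM x <= t)%N by rewrite -sM count_size.
  have : (w V AV x <= t)%N by rewrite -sV count_size.
  suff : (w M AM x == 0%N) || (w V AV x == 0%N) by lia.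
  rewrite !eqn0Ngt -!has_count -negb_and; apply/negP.
  case/andP=> /hasP[a aM xaA] /hasP[b bV xbA].
  by have := ltMV.1 _ _ aM xbA; have := ltMV.2 _ _ xaA bV; clear; lia.
have := leq_sum (sums s) (fun x (_ : true) => pointwise x).
rewrite -/(ipopsum s t) !big_split /= !sum_sums_count //.
rewrite (eq_bigr (fun=> size AM)) => [|a _]; last by rewrite count_predT.
rewrite big_const_seq iter_addn_0 count_predT.
rewrite (eq_bigr (fun=> size AV)) => [|a _]; last by rewrite count_predT.
rewrite big_const_seq iter_addn_0 count_predT.
have -> : (\sum_(x <- sums s) (ireps s x < t) * (w L s x + w U s x) =
   \sum_(a <- L) unpopular s t a + \sum_(a <- U) unpopular s t a)%N.
  rewrite -!(@sum_sums_count s _ s (fun x => (ireps s x < t)%N)) //.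
  rewrite -big_split [RHS]big_mkcond /=.
  by apply: eq_bigr => x _; case: ifP; rewrite ?mul1n.
move=> le_Phi; have sAMV : (size AM + size AV = 2 * (size s - 2 * t))%N.
  by rewrite sE /AM /AV !size_cat; lia.
(* Averaging over the [t] elements of each extreme block selects [l] and [u]. *)
have [l lL hl] : exists2 a, a \in L &
    (size L * unpopular s t a <= \sum_(b <- L) unpopular s t b)%N.
  by apply: leq_count_sum; rewrite sL.
have [u uU' hu] : exists2 a, a \in U &
    (size U * unpopular s t a <= \sum_(b <- U) unpopular s t b)%N.
  by apply: leq_count_sum; rewrite sU.
rewrite sL in hl; rewrite sU in hu; exists l, u; split=> //.
apply: leq_trans le_Phi; rewrite sM sV; clear -hl hu sAMV; nia.
Qed.

(** * Reduction modulo [m], and from subgroups to progressions *)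

(** The type ['Z_m] has two elements when [m <= 1], hence the bound on [m]. *)
Lemma intr_Zp_eq0 (m : nat) (z : int) : (1 < m)%N ->
  ((z%:~R : 'Z_m) == 0) = (m %| `|z|)%N.
Proof.
move=> m1; have natE n : ((n%:R : 'Z_m) == 0) = (m %| n)%N.
  by rewrite -val_eqE /= val_Zp_nat.
by case: z => n; rewrite ?NegzE ?mulrNz ?oppr_eq0 ?abszN -natE.
Qed.

(** Each residue class [z] collects at least [minn (reps A z) t] from the integer sums lying in it.
    If [l + a] and [u + a] are both popular, their common class holds two distinct sums worth [t]
    each, a gain of [t]; distinct [a] in [r] give distinct classes. *)
Lemma leq_popsum_mod (m t : nat) (s r : seq int) (l u : int) :
  uniq s -> l \in s -> u \in s -> l != u ->
  l%:~R = u%:~R :> 'Z_m -> uniq r -> {subset r <= s} ->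
  {in r &, injective (fun a => a%:~R : 'Z_m)} ->
  (popsum [set z in [seq a%:~R : 'Z_m | a <- r]] t +
   t * count (fun a => (t <= ireps s (l + a)%R) && (t <= ireps s (u + a)%R)) r
     <= ipopsum s t)%N.
Proof.
move=> us lS uS lu eq_lu ur sr inj.
pose p (a : int) := a%:~R : 'Z_m; set A := [set z in _].
pose E := [seq a <- r | (t <= ireps s (l + a))%N && (t <= ireps s (u + a))%N].
pose W := [set z in [seq p (l + a) | a <- E]].
have pD a b : p (a + b) = p a + p b by rewrite /p rmorphD.
have cW : #|W| = size E.
  rewrite cardsE -(size_map (fun a => p (l + a))); apply/card_uniqP.
  rewrite map_inj_in_uniq ?filter_uniq // => a b.
  rewrite !mem_filter => /andP[_ ar] /andP[_ br].
  by rewrite !pD => /addrI /inj ->.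
rewrite -size_filter -/E -cW mulnC -sum_nat_const big_mkcond /= -big_split /=.
rewrite /ipopsum (partition_big p xpredT) //=; apply: leq_sum => z _.
have le1 : (minn (reps A z) t
    <= \sum_(x <- sums s | p x == z) minn (ireps s x) t)%N.
  apply: leq_trans (minn_sum_leq _ _ _ _).
  rewrite leq_min geq_minr andbT; apply: leq_trans (geq_minl _ _) _.
  rewrite sum_sums_count //.
  have -> : reps A z = count (fun a => z - p a \in A) r.
    rewrite -size_filter -(size_map p) -(card_uniqP _); last first.
      rewrite map_inj_in_uniq ?filter_uniq // => a b.
      by rewrite !mem_filter => /andP[_ ar] /andP[_ br] /inj ->.
    apply: eq_card => y; rewrite !inE; apply/andP/mapP.
      by case=> /mapP[a ar ->] h; exists a; rewrite // mem_filter ar andbT inE.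
    case=> a; rewrite mem_filter inE => /andP[h ar] ->; split=> //.
    exact: map_f.
  rewrite -sum1_count big_mkcond /=.
  apply: (@leq_trans (\sum_(a <- r) count (fun b => p (a + b)%R == z) s)%N).
    apply: leq_sum => a _; case: ifP => //; rewrite inE => /mapP[b br zE].
    rewrite -has_count; apply/hasP; exists b; first exact: sr.
    by rewrite pD -[p b]zE addrC subrK.
  have [s' ps] : exists s', perm_eq s (r ++ s').
    exists [seq a <- s | a \notin r].
    apply: perm_trans (_ : perm_eq s ([seq a <- s | a \in r] ++ _)) _.
      by rewrite perm_sym; apply/permPl/perm_filterC.
    rewrite perm_cat2r; apply: uniq_perm; rewrite ?filter_uniq // => a.
    by rewrite mem_filter; case ar : (a \in r) => //=; rewrite sr.
  by rewrite (perm_big _ ps) big_cat /= leq_addr.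
have [zW|_] := boolP (z \in W); last by rewrite addn0.
apply: leq_trans (_ : (t + t <= _)%N); first by rewrite leq_add2r geq_minr.
move: zW; rewrite inE => /mapP[a].
rewrite mem_filter => /andP[/andP[la ua] ar] zE.
have inX b : b \in s -> b + a \in sums s.
  move=> bs; rewrite mem_undup; apply/allpairsP.
  by exists (b, a); split=> //; apply: sr.
rewrite (big_rem (l + a)) ?inX //= zE eqxx (big_rem (u + a)) /=; last first.
  rewrite mem_rem_uniq ?undup_uniq // inE inX //.
  by rewrite (inj_eq (addIr a)) eq_sym lu.
rewrite [p (u + a)]pD [p (l + a)]pD {1}/p -eq_lu eqxx.
by rewrite (minn_idPr la) (minn_idPr ua) addnA leq_addr.
Qed.

(** Take for [q] the least positive integer whose class lies in [H]. Division with remainder shows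
    that it divides every such integer, in particular [m], and its multiples below [m] give [m / q]
    elements of [H]. *)
Lemma subgroup_Zp_period (m : nat) (H : {set 'Z_m}) : (1 < m)%N ->
  0 \in H -> {in H &, forall d e, d + e \in H} ->
  {in H, forall d, - d \in H} ->
  exists q k : nat, [/\ (0 < q)%N, m = (k * q)%N, (k <= #|H|)%N &
    forall z : int, z%:~R \in H -> (q %| `|z|)%N].
Proof.
move=> m1 H0 HD HN.
have exq : exists q, (0 < q)%N && ((q%:R : 'Z_m) \in H).
  by exists m; rewrite pchar_Zp // H0 andbT; lia.
case: (ex_minnP exq) => q /andP[q0 qH] q_min.
have HM n : ((n * q)%:R : 'Z_m) \in H.
  by elim: n => // n IH; rewrite mulSn natrD HD.
have dvdq n : (n%:R : 'Z_m) \in H -> (q %| n)%N.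
  move=> nH; rewrite /dvdn; case: (posnP (n %% q)) => [//|r0].
  have : ((n %% q)%:R : 'Z_m) \in H.
    have -> : ((n %% q)%:R : 'Z_m) = n%:R - (n %/ q * q)%:R.
      by rewrite {2}(divn_eq n q) natrD addrAC subrr add0r.
    by rewrite HD ?HN.
  move=> rH; have := q_min (n %% q)%N; rewrite r0 rH leqNgt ltn_pmod //.
  by move/(_ isT).
have qm : (q %| m)%N by apply: dvdq; rewrite pchar_Zp.
exists q, (m %/ q)%N; split=> //; first by rewrite divnK.
  pose f (i : 'I_(m %/ q)) := (i * q)%:R : 'Z_m.
  have ltf (i : 'I_(m %/ q)) : (i * q < m)%N by rewrite -ltn_divRL.
  have f_inj : injective f.
    move=> i j /(congr1 val); rewrite /= !val_Zp_nat // !modn_small // => /eqP.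
    by rewrite eqn_pmul2r // => /eqP /val_inj.
  rewrite -[X in (X <= _)%N]card_ord -(card_imset _ f_inj).
  apply: subset_leq_card; apply/fintype.subsetP => _ /imsetP[i _ ->].
  exact: HM.
case=> n; first exact: dvdq.
rewrite NegzE abszN mulrNz => /HN; rewrite opprK; apply: dvdq.
Qed.

(** The first term is the least integer from [l] on congruent to [y]; the index of [x] is the
    quotient of [x - l] by [q], below [k] because [x - l < k q]. *)
Lemma mem_arith_prog (l u x y : int) (q k : nat) :
  (0 < q)%N -> u - l = (k * q)%N%:Z -> l <= x < u -> (q %| `|x - y|)%N ->
  x \in [seq l + ((y - l) %% q)%Z + i%:Z * q%:Z | i <- iota 0 k].
Proof.
move=> q0 ulE /andP[lx xu] qxy.
have modE : ((x - l) %% q)%Z = ((y - l) %% q)%Z.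
  by apply/eqP; rewrite eqz_mod_dvd /= opprB addrA subrK dvdzE.
have div0 : 0 <= ((x - l) %/ q)%Z by rewrite divz_ge0 ?subr_ge0 //; lia.
have := divz_eq (x - l) q; rewrite modE => xlE.
apply/mapP; exists `|((x - l) %/ q)%Z|%N; last first.
  by rewrite gez0_abs //; lia.
rewrite mem_iota /= add0n.
have : ((x - l) %/ q)%Z < k by rewrite ltz_divLR; lia.
by lia.
Qed.

(** * The theorem for sorted sequences of integers *)

(** The form of the theorem with [delta] eliminated: the length is bounded through [ipopsum s t],
    and all inequalities are free of subtraction. *)
Lemma popular_doubling_int (s : seq int) (t : nat) :
  sorted <%R s -> (0 < t)%N -> (20 * t <= size s)%N ->
  (4 * ipopsum s t + 20 * t ^ 2 <= 9 * t * size s)%N ->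
  exists (a : int) (q k : nat), [/\ (0 < q)%N, (0 < k)%N,
    (t * k + 3 * t * size s <= 2 * ipopsum s t + 6 * t ^ 2)%N &
    (2 * count [predC [seq (a + i%:Z * q%:Z)%R | i <- iota 0 k]] s <= 5 * t)%N].
Proof.
move=> s_sort t0 hN hPhi.
have us : uniq s by apply: lt_sorted_uniq.
have [L [M [C [V [U [sE sL sM sV sU]]]]]] :
    exists L M C V U, [/\ s = L ++ M ++ C ++ V ++ U,
    size L = t, size M = t, size V = t & size U = t].
  pose r := drop t (drop t s); pose r' := drop (size s - 4 * t) r.
  exists (take t s), (take t (drop t s)), (take (size s - 4 * t) r).
  exists (take t r'), (drop t r'); rewrite /r' /r.
  by rewrite !cat_take_drop !(size_take_min, size_drop); split=> //; lia.
have [l [u [lL uU lam_le]]] := popular_extremes sE s_sort t0 sL sM sV sU.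
have : pairwise <%R (L ++ M ++ C ++ V ++ U).
  by rewrite -sE -(sorted_pairwise (@lt_trans _ _)).
rewrite !pairwise_cat => /and3P[/allrelP hL _ /and3P[/allrelP hM _]].
move=> /and3P[/allrelP hC _ /and3P[/allrelP hV _ _]].
(* Elements of [M] and [C] separate [l] from [u], which yields [1 < m]. *)
have [a aM] : exists a : int, a \in M.
  by exists (nth 0 M 0); rewrite mem_nth // sM.
have [c cC] : exists c : int, c \in C.
  exists (nth 0 C 0); rewrite mem_nth //.
  have : size s = (size L + (size M + (size C + (size V + size U))))%N.
    by rewrite sE !size_cat.
  rewrite sL sM sV sU; move: (size s) (size C) hN t0; clear; lia.
have lS : l \in s by rewrite sE mem_cat lL.
have uS : u \in s by rewrite sE !mem_cat uU !orbT.
have la : l < a by apply: hL; rewrite ?mem_cat ?aM.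
have ac : a < c by apply: hM; rewrite ?mem_cat ?cC.
have cu : c < u by apply: hC; rewrite ?mem_cat ?uU ?orbT.
pose lo := count (fun x : int => x < l) s.
have cnt_lo : (lo < t)%N.
  rewrite /lo sE count_cat [X in (_ + X)%N](_ : _ = 0%N); last first.
    apply/eqP; rewrite -leqn0 leqNgt -has_count; apply/hasPn => x xR.
    by rewrite -leNgt ltW // hL.
  rewrite addn0 -sL -(count_predC (fun x : int => x < l) L) -addn1 leq_add2l.
  by rewrite -has_count; apply/hasP; exists l; rewrite //= ltxx.
pose hi := count (fun x : int => u <= x) s.
have cnt_hi : (hi <= t)%N.
  rewrite /hi sE !catA count_cat [X in (X + _)%N](_ : _ = 0%N); last first.
    apply/eqP; rewrite -leqn0 leqNgt -has_count; apply/hasPn => x.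
    rewrite -ltNge !mem_cat -!orbA => /or4P[] h.
    - by apply: hL; rewrite // !mem_cat uU !orbT.
    - by apply: hM; rewrite // !mem_cat uU !orbT.
    - by apply: hC; rewrite // !mem_cat uU !orbT.
    - by apply: hV.
  by rewrite add0n -sU count_size.
pose r := [seq x <- s | l <= x < u].
have ur : uniq r by rewrite filter_uniq.
have sr : {subset r <= s} by move=> x; rewrite mem_filter => /andP[].
have rP x : x \in r -> l <= x < u by rewrite mem_filter => /andP[].
(* Passing to [[l, u)] loses fewer than [2t] points: those below [l] lie in [L] and exclude [l],
   those from [u] on lie in [U]. *)
have cnt (P : pred int) : (count P s < 2 * t + count P r)%N.
  apply: (@leq_trans (lo + hi + count P r).+1); last first.
    by clear -cnt_lo cnt_hi; lia.
  rewrite ltnS count_filter /lo /hi; clear; elim: (s) => //= x q IH.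
  have : (P x <= (x < l)%R + (u <= x)%R + (P x && (l <= x < u)%R))%N.
    by case: (P x) => //=; case: (ltrP x l) => //= _; case: (lerP u x).
  by move: IH; lia.
have size_r : (size s < size r + 2 * t)%N.
  by have := cnt predT; rewrite !count_predT addnC.
pose m := `|u - l|%N.
have mE : u - l = m%:Z by clear -la ac cu; rewrite gez0_abs; lia.
have m1 : (1 < m)%N by clear -la ac cu mE; lia.
pose p (a : int) := a%:~R : 'Z_m.
have pB x y : p (x - y) = p x - p y by rewrite /p rmorphB.
have p_inj : {in r &, injective p}.
  move=> x y /rP xr /rP yr /eqP; rewrite -subr_eq0 -pB intr_Zp_eq0 // => dvd_m.
  apply/eqP; rewrite -subr_eq0 -absz_eq0; apply: contraTT dvd_m => nz.
  by clear -xr yr nz mE; rewrite gtnNdvd //; lia.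
have p_lu : p l = p u.
  by apply/esym/eqP; rewrite -subr_eq0 -pB intr_Zp_eq0.
have lu : l != u by clear -la ac cu; lia.
have := leq_popsum_mod t us lS uS lu p_lu ur sr p_inj.
set A := [set z in _]; set E := count _ _ => le_K.
have cA : #|A| = size r.
  rewrite cardsE -(size_map p); apply/card_uniqP.
  by rewrite map_inj_in_uniq.
have le_E : (size r <= E + unpopular s t l + unpopular s t u)%N.
  have le_unp b :
      (count (fun x => ireps s (b + x)%R < t) r <= unpopular s t b)%N.
    by rewrite /unpopular count_filter; apply: sub_count => x /andP[].
  apply: leq_trans (leq_add (leq_add (leqnn E) (le_unp l)) (le_unp u)).
  rewrite /E; clear; elim: r => //= x r' IH.
  move: IH; case: (leqP t (ireps s (l + x))) => _;
    by case: (leqP t (ireps s (u + x))) => _ /=; lia.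
(* Add [lam_le] and [le_K], each costing one [ipopsum s t]; by [le_E] the unpopular terms complete
   [t E] to at least [t |r|]. *)
have le_K2 : (popsum A t + t * size r + 2 * t * (size s - 2 * t) <=
    2 * ipopsum s t)%N.
  have : (t * size r <= t * (E + unpopular s t l + unpopular s t u))%N.
    by rewrite leq_mul2l le_E orbT.
  move: lam_le le_K; clear; nia.
have [n' sizeE] : exists n', (size s = n' + 2 * t)%N.
  by exists (size s - 2 * t)%N; clear -hN; lia.
have [||//|H [x [[H0 HD HN] xA le_H le_bad]]] := @small_popular_doubling _ A t.
(* Here [2 popsum A t <= 5t n' - 2t^2 - 2t|r|], and [n' <= |r|] gives the required
   [3t|r| - 2t^2]. *)
- rewrite cA; move: le_K2 size_r hPhi; rewrite sizeE addnK.
  by clear; nia.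
- by rewrite cA; clear -size_r hN; lia.
have [q [k [q0 mkq le_kH dvdq]]] := subgroup_Zp_period m1 H0 HD HN.
have [y yr xE] : exists2 y, y \in r & x = p y.
  by move: xA; rewrite inE => /mapP.
exists (l + ((y - l) %% q)%Z), q, k; split=> //.
- by rewrite lt0n; apply: contraTneq m1 => k0; rewrite mkq k0.
(* By [le_K2] this is at most [2 ipopsum s t - 3t n'], and [n' = |s| - 2t] produces the term
   [6t^2]. *)
- have : (t * k <= popsum A t)%N.
    by apply: leq_trans le_H; rewrite leq_mul2l le_kH orbT.
  have : (t * n' <= t * size r)%N.
    by rewrite leq_mul2l; apply/orP; right; clear -size_r sizeE; lia.
  move: le_K2; rewrite sizeE addnK; clear.
  move: (popsum A t) (ipopsum s t) (size r) => K F w; nia.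
set P := [seq _ | i <- _].
(* Points of [r] off the progression reduce injectively to exceptional elements of [A], at most
   [t/2] in number; with the [2t] points outside [[l, u)] this makes [5t/2]. *)
have : (count [predC P] r <= #|[set y in A | (x - y)%R \notin H]|)%N.
  have -> : #|[set y in A | (x - y)%R \notin H]| =
      count (fun z => p (y - z)%R \notin H) r.
    rewrite -size_filter -(size_map p) -(card_uniqP _); last first.
      rewrite map_inj_in_uniq ?filter_uniq // => z z'.
      rewrite mem_filter => /andP[_ zr]; rewrite mem_filter => /andP[_ zr'].
      by move/p_inj ->.
    apply: eq_card => w; rewrite !inE; apply/andP/mapP.
      case=> /mapP[z zr ->] h; exists z => //.
      by rewrite mem_filter zr andbT pB -xE.
    case=> z; rewrite mem_filter pB -xE => /andP[h zr] ->; split=> //.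
    exact: map_f.
  rewrite -!size_filter; apply: uniq_leq_size; first by rewrite filter_uniq.
  move=> z; rewrite mem_filter => /andP[zP zr]; rewrite mem_filter zr andbT.
  apply: contra zP => /dvdq; rewrite -abszN opprB => zy.
  by apply: (@mem_arith_prog l u) => //; [rewrite mE mkq | apply: rP].
move: (cnt [predC P]) le_bad; clear.
move: (count _ s) (count _ r) #|_| => v w z; lia.
Qed.

(** * Translation from convolutions of indicator functions *)

Local Open Scope classical_set_scope.
Local Open Scope ring_scope.

Lemma conv_indic_ireps (R : realType) (S : {fset int}) (s : seq int) (x : int) :
  perm_eq S s ->
  conv (\1_[set` S] : int -> R) (\1_[set` S] : int -> R) x = (ireps s x)%:R.
Proof.
move=> pS; have inS y : (\1_[set` S] y : R) = (y \in S)%:R.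
  by rewrite indicE mem_setE.
rewrite /conv (fsbigTE S) => [|y /negbTE yS]; last by rewrite inS yS mul0r.
rewrite (perm_big _ pS) /= /ireps -sum1_count natr_sum [RHS]big_mkcond /=.
apply: eq_big_seq => y; rewrite -(perm_mem pS) !inS => ->.
by rewrite mul1r -(perm_mem pS); case: (_ \in _).
Qed.

Lemma fsbig_min_conv (R : realType) (S : {fset int}) (s : seq int) (t : nat) :
  perm_eq S s ->
  \sum_(x \in [set: int])
      Num.min (conv (\1_[set` S] : int -> R) (\1_[set` S] : int -> R) x) t%:R
    = (ipopsum s t)%:R.
Proof.
move=> pS.
have minE x : Num.min
    (conv (\1_[set` S] : int -> R) (\1_[set` S] : int -> R) x) t%:R
    = (minn (ireps s x) t)%:R.
  rewrite (conv_indic_ireps _ _ pS).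
  by case: (leqP (ireps s x) t) => [le|/ltnW le];
    [rewrite min_l|rewrite min_r]; rewrite ?ler_nat.
rewrite (@fsbigE _ _ _ _ _ (sums s)) ?undup_uniq //.
  rewrite /ipopsum natr_sum; apply: eq_big => x //; by rewrite in_setT.
move=> x _; apply: contraNeq; rewrite minE pnatr_eq0 => nz.
have : (0 < ireps s x)%N by lia.
rewrite -has_count => /hasP[a aS xaS].
rewrite mem_undup; apply/allpairsP; exists (a, x - a); split=> //=.
by rewrite addrC subrK.
Qed.

Theorem theorem1p1 (R : realType) (S : {fset int}) (N t : nat) (delta : R) :
  #|` S| = N -> (0 < N)%N -> (0 < t)%N -> 0 < delta ->
  \sum_(x \in [set: int])
      Num.min (conv (\1_[set` S] : int -> R) (\1_[set` S] : int -> R) x) t%:R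
    <= (2 + delta) * N%:R * t%:R ->
  delta + 5 * t%:R / N%:R <= 1 / 4 ->
  exists P : {fset int},
    [/\ is_arith_prog P,
        #|` P|%:R <= (1 + 2 * delta) * N%:R + 6 * t%:R
      & #|` (S `\` P)%fset|%:R <= 5 * t%:R / 2 :> R].
Proof.
move=> SN N0 t0 delta0.
pose s := sort <=%R (S : seq int).
have pS : perm_eq S s by rewrite perm_sym perm_sort.
have s_sort : sorted <%R s.
  rewrite lt_sorted_uniq_le sort_uniq fset_uniq /=.
  by rewrite sort_sorted //; apply: le_total.
have sN : size s = N by rewrite -(perm_size pS).
rewrite (fsbig_min_conv _ _ pS) => hPhi hdelta.
have N0' : 0 < N%:R :> R by rewrite ltr0n.
have t0' : 0 < t%:R :> R by rewrite ltr0n.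
have hdN : delta * N%:R + 5 * t%:R <= N%:R / 4.
  have := ler_wpM2r (ltW N0') hdelta.
  by rewrite mulrDl divfK ?gt_eqF // => h; lra.
have hN : (20 * t <= size s)%N.
  rewrite sN -(ler_nat R) natrM; have := mulr_gt0 delta0 N0'; lra.
(* Replacing [delta N] by [N/4 - 5t] in [hPhi] removes [delta] and gives [9Nt/4 - 5t^2]. *)
have hdNt : (delta * N%:R + 5 * t%:R) * t%:R <= N%:R / 4 * t%:R.
  by rewrite ler_pM2r.
have hPhi' : (4 * ipopsum s t + 20 * t ^ 2 <= 9 * t * size s)%N.
  by rewrite sN -(ler_nat R) natrD !natrM; lra.
have [a [q [k [q0 k0 hlen hbad]]]] := popular_doubling_int s_sort t0 hN hPhi'.
pose P := [fset (a + i%:Z * q%:Z)%R | i in iota 0 k]%fset.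
have memP x : (x \in P) = (x \in [seq a + i%:Z * q%:Z | i <- iota 0 k]).
  by apply/imfsetP/mapP => -[i /= ik ->]; exists i.
exists P; split.
- by exists a, q%:Z, k; split=> //; lia.
- have leP : (#|` P| <= k)%N.
    rewrite -[k in (_ <= k)%N](size_iota 0).
    rewrite -(size_map (fun i : nat => a + i%:Z * q%:Z)).
    by apply: uniq_leq_size (fset_uniq _) _ => x; rewrite -memP.
  have tP : (t * #|` P| + 3 * t * N <= 2 * ipopsum s t + 6 * t ^ 2)%N.
    apply: leq_trans (_ : (t * k + 3 * t * size s <= _)%N) => //.
    by rewrite sN leq_add2r leq_mul2l leP orbT.
  (* Here [delta] returns: [2 (2 + delta) N t - 3 N t + 6t^2] is [t] times the claimed length. *)
  move: tP; rewrite -(ler_nat R) !natrD !natrM => tP.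
  by rewrite -(ler_pM2l t0'); lra.
- have -> : #|` (S `\` P)%fset| =
      count [predC [seq (a + i%:Z * q%:Z)%R | i <- iota 0 k]] s.
    rewrite -size_filter; apply/perm_size/uniq_perm;
      rewrite ?fset_uniq ?filter_uniq ?sort_uniq //.
    by move=> x; rewrite inE memP mem_filter -(perm_mem pS).
  by move: hbad; rewrite -(ler_nat R) !natrM; lra.
Qed.
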